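(* Let $K$ be a knotoid in $S^2$ with affine index polynomial $P_K(t)\in\mathbb{Z}[t,t^{-1}]$. Then $P_K(t)$ is symmetric with respect to $t\leftrightarrow t^{-1}$, that is, $P_K(t)=P_K(t^{-1})$. Therefore $P_K(t)=P_{\overline{K}}(t)$, where $\overline{K}$ denotes the inverse of $K$.
   Context: A knotoid diagram in $S^2$ is a generic immersion of $[0,1]$ into the oriented sphere $S^2$ whose only singularities are finitely many transversal double points, each endowed with over/under information (classical crossings). The images of $0$ and $1$ (the tail and the head) are distinct from each other and from the crossings, and the diagram is oriented from tail to head. The $\Omega$-moves are the three Reidemeister moves $\Omega_1,\Omega_2,\Omega_3$ performed inside small disks not containing the endpoints (pulling the strand adjacent to an endpoint over or under another strand is not allowed). Two knotoid diagrams in $S^2$ are equivalent if they are related by a finite sequence of $\Omega$-moves and isotopy of $S^2$; a knotoid in $S^2$ is an equivalence class. The inverse $\overline{K}$ is obtained by reversing the orientation of a diagram (so the tail becomes the head). Affine index polynomial. Let $F(K)$ be the underlying flat diagram of a diagram $K$, obtained by forgetting the over/under information. Its arcs are the edges between consecutive vertices, where the vertices are the flat crossings and the two endpoints. Label the arcs by integers: the first arc (starting at the tail) has label $0$. At each flat crossing, drawn with both strands oriented upwards, the strand going from bottom right to top left has its label increased by $1$ and the strand going from bottom left to top right has its label decreased by $1$. For a crossing $c$ let $a$ and $b$ be the labels of the left and right incoming arcs at the corresponding flat crossing, and set $w_+(c)=a-(b+1)$, $w_-(c)=b-(a-1)$. The weight $w_K(c)$ is $w_+(c)$ if $c$ is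 a positive crossing and $w_-(c)$ if $c$ is a negative crossing. Then $$P_K(t)=\sum_c \mathrm{sgn}(c)\,(t^{w_K(c)}-1),$$ the sum over all classical crossings, with $\mathrm{sgn}(c)=\pm1$ the sign of $c$. $P_K(t)$ depends only on the knotoid. *)

(* Defs.v *)
From HB Require Import structures.
From mathcomp Require Import all_boot all_order all_algebra.
From mathcomp Require Import generic_quotient finmap monalg boolp.
From Stdlib Require Import Relation_Operators.

Set Implicit Arguments.
Unset Strict Implicit.
Unset Printing Implicit Defensive.

Import GRing.Theory.

(* A knotoid diagram in S^2 up to isotopy is encoded by the sequence of its
   passages through crossings from the tail to the head (a signed Gauss code)
   for which the associated 4-valent graph, with its two endpoints, is cellularly
   embedded in the oriented sphere: the code determines the cyclic order of the
   half-edges around each vertex, hence a closed oriented surface, which must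
   have Euler characteristic 2.
   A passage (c, o, s) goes through the crossing named c, on the over strand
   iff o, and the sign of c is +1 iff s. *)
Definition passage : Type := (nat * bool * bool)%type.

Definition crossing (x : passage) : nat := x.1.1.
Definition over (x : passage) : bool := x.1.2.
Definition positive (x : passage) : bool := x.2.

(* Each crossing is passed exactly twice, once over and once under, and both
   passages carry the same sign. *)
Definition well_formed (w : seq passage) : bool :=
  uniq [seq (crossing x, over x) | x <- w] &&
  all (fun x => (crossing x, ~~ over x, positive x) \in w) w.

(* With both strands oriented upwards, the over strand goes from bottom left to
   top right at a positive crossing and from bottom right to top left at a
   negative one. *)
Definition from_left (x : passage) : bool := over x == positive x.

Section Code.
Variable w : seq passage.

Definition letter (i : nat) : passage := nth (0, false, false)%N w i.

(* Position of the other passage through the crossing passed at position i. *)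
Definition partner (i : nat) : nat :=
  find (fun y => (crossing y == crossing (letter i)) &&
                 (over y != over (letter i))) w.

(* The arcs are numbered 0, ..., size w from the tail to the head; the passage at
   position i enters along arc i and leaves along arc i.+1.  The dart (k, true)
   is the half of arc k at its initial vertex, (k, false) the half of arc k at
   its final vertex. *)
Definition dart : Type := ('I_(size w).+1 * bool)%type.

Definition incoming (i : nat) : dart := (inord i, false).
Definition outgoing (i : nat) : dart := (inord i.+1, true).

Definition opposite (d : dart) : dart := (d.1, ~~ d.2).

(* Counterclockwise rotation around the vertices.  At a crossing the order is
   left incoming, right incoming, left strand outgoing, right strand outgoing;
   the tail and the head are univalent. *)
Definition rotate (d : dart) : dart :=
  let: (k, out) := d in
  if out then
    if k == 0 :> nat then d
    else if from_left (letter k.-1) then outgoing (partner k.-1)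
    else incoming (partner k.-1)
  else
    if k == size w :> nat then d
    else if from_left (letter k) then incoming (partner k)
    else outgoing (partner k).

Definition face_step (d : dart) : dart := rotate (opposite d).

Definition spherical : bool :=
  fcard rotate predT + fcard face_step predT == fcard opposite predT + 2.

(* Some complementary region is a triangle whose sides are the arcs k1, k2, k3. *)
Definition triangular_face (k1 k2 k3 : nat) : Prop :=
  exists d1 d2 d3 : dart,
    fcycle face_step [:: d1; d2; d3] /\
    perm_eq [seq nat_of_ord d.1 | d <- [:: d1; d2; d3]] [:: k1; k2; k3].

Local Open Scope ring_scope.

Definition arc_label (k : nat) : int :=
  \sum_(x <- take k w) (if from_left x then -1 else 1).

(* w_+ or w_- at the crossing whose left incoming arc is arc i. *)
Definition weight (i : nat) : int :=
  let a := arc_label i in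
  let b := arc_label (partner i) in
  if positive (letter i) then a - (b + 1) else b - (a - 1).

Definition crossing_sign (x : passage) : int := if positive x then 1 else -1.

(* {malg int[int]} is the free Z-module on the monomials t^n = << n >>, n : int,
   i.e. Z[t, t^-1].  Exactly one of the two passages of a crossing comes from
   the left, so the sum runs over the crossings. *)
Definition code_aip : {malg int[int]} :=
  \sum_(i < size w | from_left (letter i))
     (<< weight i >> - << 0 >>) *~ crossing_sign (letter i).

End Code.

(* The substitution t |-> t^-1 in a Laurent polynomial. *)
Definition subst_inv (p : {malg int[int]}) : {malg int[int]} :=
  (\sum_(n <- msupp p) << p@_n *g - n >>)%R.

Definition diagram : Type := {w : seq passage | well_formed w && spherical w}.

(* Reversing the orientation of a diagram keeps the signs of the crossings. *)
Section Reversal.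

Lemma uniq_map_inj (T U : eqType) (f : T -> U) (s : seq T) :
  uniq (map f s) -> {in s &, injective f}.
Proof.
elim: s => //= v s IH /andP[nv us] z t; rewrite !inE.
move=> /predU1P[->|zw] /predU1P[->|tw] // e.
- by case/negP: nv; rewrite e map_f.
- by case/negP: nv; rewrite -e map_f.
- exact: IH.
Qed.

Lemma partnerP w i : well_formed w -> (i < size w)%N ->
  [/\ (partner w i < size w)%N,
      crossing (letter w (partner w i)) = crossing (letter w i),
      over (letter w (partner w i)) = ~~ over (letter w i) &
      from_left (letter w (partner w i)) = ~~ from_left (letter w i)].
Proof.
case/andP=> uw /allP aw lt_i; set x := letter w i.
have xw : x \in w by apply: mem_nth.
set a := fun y => (crossing y == crossing x) && (over y != over x).
have ha : has a w.
  by apply/hasP; exists (crossing x, ~~ over x, positive x); rewrite ?aw // /a eqxx;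
     case: (over x).
have lt_p : (partner w i < size w)%N by rewrite -has_find.
have /andP[/eqP e1 e2] : a (letter w (partner w i)) by apply: nth_find.
have e2' : over (letter w (partner w i)) = ~~ over x.
  by move: e2; case: (over x); case: (over _).
split=> //; set y := letter w (partner w i) in e1 e2 e2' *.
suff -> : y = (crossing x, ~~ over x, positive x).
  by rewrite /from_left /over /positive /=; case: (x) => [[? []] []].
have yw : y \in w by apply: mem_nth.
by apply: (uniq_map_inj uw); rewrite ?aw //= e1 e2'.
Qed.

Lemma partner_uniq w i j : well_formed w -> (i < size w)%N -> (j < size w)%N ->
  crossing (letter w j) = crossing (letter w i) ->
  over (letter w j) = ~~ over (letter w i) -> partner w i = j.
Proof.
move=> wf lt_i lt_j e1 e2; have [lt_p f1 f2 _] := partnerP wf lt_i.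
case/andP: wf => uw _; pose g (z : passage) := (crossing z, over z).
apply/eqP; rewrite -(nth_uniq (0%N, false) _ _ uw) ?size_map //.
rewrite !(nth_map (0, false, false)%N) //; rewrite /letter in e1 e2 f1 f2 *.
by rewrite e1 e2 f1 f2.
Qed.

Lemma partnerK w i : well_formed w -> (i < size w)%N ->
  partner w (partner w i) = i.
Proof.
move=> wf lt_i; have [lt_p f1 f2 _] := partnerP wf lt_i.
by apply: partner_uniq => //; rewrite f2 negbK.
Qed.

Lemma rotate_inj w : well_formed w -> injective (@rotate w).
Proof.
move=> wf; suff r4 (d : dart w) : rotate (rotate (rotate (rotate d))) = d.
  by move=> d e de; rewrite -(r4 d) de r4.
have inc i : (i < size w)%N -> rotate (incoming w i) =
    if from_left (letter w i) then incoming w (partner w i) else outgoing w (partner w i).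
  by move=> lt_i; rewrite /rotate /incoming inordK ?ltnS ?(ltnW lt_i) // ltn_eqF.
have out i : (i < size w)%N -> rotate (outgoing w i) =
    if from_left (letter w i) then outgoing w (partner w i) else incoming w (partner w i).
  by move=> lt_i; rewrite /rotate /outgoing inordK ?ltnS.
have P i (lt_i : (i < size w)%N) := partnerP wf lt_i.
have K i (lt_i : (i < size w)%N) := partnerK wf lt_i.
have R i : (i < size w)%N ->
    rotate (rotate (rotate (rotate (incoming w i)))) = incoming w i /\
    rotate (rotate (rotate (rotate (outgoing w i)))) = outgoing w i.
  move=> lt_i; have [lt_p _ _ fl] := P i lt_i.
  have := inc _ lt_i; have := out _ lt_i.
  have := inc _ lt_p; have := out _ lt_p; rewrite fl K //.
  by case: (from_left (letter w i)) => E1 E2 E3 E4;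
     split; rewrite 4!(E1, E2, E3, E4).
case: d => k [].
  have [k0|k_gt0] := posnP k.
    by have r : rotate (k, true) = (k, true); [rewrite /rotate k0 | rewrite !r].
  have -> : (k, true) = outgoing w k.-1.
    by congr (_, _); apply: val_inj; rewrite /= prednK // inordK.
  by apply: (R k.-1 _).2; rewrite prednK // -ltnS.
have [kN|kN] := eqVneq (k : nat) (size w).
  by have r : rotate (k, false) = (k, false); [rewrite /rotate kN eqxx | rewrite !r].
have -> : (k, false) = incoming w k by rewrite /incoming inord_val.
by apply: (R k _).1; rewrite ltn_neqAle kN -ltnS ltn_ord.
Qed.

Lemma fcard_conj (T T' : finType) (f : T -> T) (g : T' -> T') (h : T -> T')
    (h' : T' -> T) : injective f -> injective g -> cancel h h' -> cancel h' h ->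
  (forall x, h (f x) = g (h x)) -> fcard f predT = fcard g predT.
Proof.
move=> fi gi hK h'K hf.
rewrite (@adjunction_n_comp _ _ h' (frel f) (frel g)) //.
- exact: fconnect_sym.
- exact: fconnect_sym.
apply: strict_adjunction; [exact: fconnect_sym | by [] | exact: can_inj h'K | |].
  by apply/subsetP => x _; apply/codomP; exists (h x).
by move=> x y _; rewrite /= -(inj_eq (can_inj hK)) hf !h'K.
Qed.

Lemma well_formed_rev w : well_formed (rev w) = well_formed w.
Proof.
rewrite /well_formed map_rev rev_uniq; congr (_ && _).
by rewrite all_rev; apply: eq_all => x; rewrite mem_rev.
Qed.

Lemma mirror_lt n i : (i < n)%N -> (n - i.+1 < n)%N.
Proof. by case: n => // n _; rewrite subSS ltnS leq_subr. Qed.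

Lemma mirrorK n i : (i < n)%N -> (n - (n - i.+1).+1)%N = i.
Proof. by case: n => // n; rewrite ltnS !subSS => /subKn. Qed.

Lemma letter_rev w i : (i < size w)%N -> letter (rev w) i = letter w (size w - i.+1).
Proof. by move=> lt_i; rewrite /letter nth_rev. Qed.

Lemma partner_rev w i : well_formed w -> (i < size w)%N ->
  partner (rev w) i = (size w - (partner w (size w - i.+1)).+1)%N.
Proof.
move=> wf lt_i; have lt_j := mirror_lt lt_i.
have [lt_p e1 e2 _] := partnerP wf lt_j.
have lt_q := mirror_lt lt_p.
by apply: partner_uniq; rewrite ?well_formed_rev ?size_rev // !letter_rev // mirrorK.
Qed.

Lemma spherical_rev w : well_formed w -> spherical (rev w) = spherical w.
Proof.
move=> wf; have wf' : well_formed (rev w) by rewrite well_formed_rev.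
pose h1 (d : dart w) : dart (rev w) := (inord (size w - d.1), ~~ d.2).
pose h2 (d : dart (rev w)) : dart w := (inord (size w - d.1), ~~ d.2).
have leN (k : 'I_(size (rev w)).+1) : (k <= size w)%N.
  by rewrite -(size_rev w) -ltnS ltn_ord.
have leM (k : 'I_(size w).+1) : (k <= size w)%N by rewrite -ltnS ltn_ord.
have h1K : cancel h1 h2.
  move=> [k b]; rewrite /h2 /h1 /= negbK; congr (_, _); apply: val_inj => /=.
  by rewrite !inordK ?ltnS ?size_rev ?leq_subr // subKn ?leM ?leN.
have h2K : cancel h2 h1.
  move=> [k b]; rewrite /h2 /h1 /= negbK; congr (_, _); apply: val_inj => /=.
  by rewrite !inordK ?ltnS ?size_rev ?leq_subr // subKn // -ltnS -?(size_rev w) ltn_ord.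
have h_in i : (i < size w)%N -> h1 (incoming w i) = outgoing (rev w) (size w - i.+1).
  move=> lt_i; rewrite /h1 /incoming /outgoing /= inordK ?ltnS ?(ltnW lt_i) //.
  by rewrite -subSn // subSS.
have h_out i : (i < size w)%N -> h1 (outgoing w i) = incoming (rev w) (size w - i.+1).
  by move=> lt_i; rewrite /h1 /incoming /outgoing /= inordK ?ltnS.
have hrot (d : dart w) : h1 (rotate d) = rotate (h1 d).
  case: d => k [] /=.
    rewrite inordK ?ltnS ?size_rev ?leq_subr //.
    have [k0|k_gt0] := posnP k; first by rewrite k0 subn0 eqxx /h1 /= k0 subn0.
    have lt_k : (k.-1 < size w)%N by rewrite prednK.
    have [lt_p _ _ _] := partnerP wf lt_k.
    have lt_k' := mirror_lt lt_k; have e : (size w - k = size w - k.-1.+1)%N.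
      by rewrite prednK.
    by rewrite e ltn_eqF // letter_rev // partner_rev // mirrorK //;
       case: ifP => _; rewrite ?h_in ?h_out.
  rewrite inordK ?ltnS ?size_rev ?leq_subr // subn_eq0.
  have [kN|kN] := eqVneq (k : nat) (size w); first by rewrite kN leqnn /h1 /= kN.
  have lt_k : (k < size w)%N by rewrite ltn_neqAle kN leM.
  have [lt_p _ _ _] := partnerP wf lt_k.
  have e : ((size w - k).-1 = size w - k.+1)%N by rewrite subnS.
  have lt_k' := mirror_lt lt_k.
  rewrite leqNgt lt_k /= e letter_rev // partner_rev // mirrorK //.
  by case: ifP => _; rewrite ?h_in ?h_out.
have hopp (d : dart w) : h1 (opposite d) = opposite (h1 d) by [].
have oinj v : injective (@opposite v).
  by apply: inv_inj => -[k b]; rewrite /opposite /= negbK.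
have finj v : well_formed v -> injective (@face_step v).
  by move=> wv; apply: inj_comp; [exact: rotate_inj | exact: oinj].
rewrite /spherical; congr (_ + _ == _ + _); symmetry.
- exact: (fcard_conj (rotate_inj wf) (rotate_inj wf') h1K h2K hrot).
- apply: (fcard_conj (finj _ wf) (finj _ wf') h1K h2K) => d.
  by rewrite /face_step hrot hopp.
- exact: (fcard_conj (oinj _) (oinj _) h1K h2K hopp).
Qed.

Lemma diagram_inverse_subproof (D : diagram) :
  well_formed (rev (val D)) && spherical (rev (val D)).
Proof.
by case: D => w /= /andP[wf sw]; rewrite well_formed_rev wf spherical_rev.
Qed.

End Reversal.

Definition diagram_inverse (D : diagram) : diagram :=
  exist _ (rev (val D)) (diagram_inverse_subproof D).

Definition diagram_aip (D : diagram) : {malg int[int]} := code_aip (val D).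

Definition flip (e : bool) (p : seq passage) : seq passage := if e then rev p else p.

(* Generators of the equivalence, applied to codes of spherical diagrams only.
   Two passages in adjacent positions are joined by an arc; the loop of Omega1
   and the bigon of Omega2 then automatically bound an empty disk: for Omega2
   this is ensured by the opposite signs of the two crossings, while for Omega3
   it has to be required.  Relabel renames the crossings. *)
Inductive code_move : seq passage -> seq passage -> Prop :=
| Relabel (f : nat -> nat) (w : seq passage) :
    injective f ->
    code_move w [seq (f (crossing x), over x, positive x) | x <- w]
| Omega1 (u v : seq passage) (c : nat) (o s : bool) :
    code_move (u ++ v) (u ++ [:: (c, o, s); (c, ~~ o, s)] ++ v)
| Omega2 (u1 u2 u3 : seq passage) (c d : nat) (o s e : bool) :
    code_move (u1 ++ u2 ++ u3)
      (u1 ++ [:: (c, o, s); (d, o, ~~ s)]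
       ++ u2 ++ flip e [:: (c, ~~ o, s); (d, ~~ o, ~~ s)] ++ u3)
(* The top strand goes over the middle one at a and over the bottom one at b,
   and the middle strand goes over the bottom one at c; they may be met in any
   order and direction. *)
| Omega3 (u0 u1 u2 u3 p1 p2 p3 : seq passage) (a b c : nat)
    (sa sb sc et em eb : bool) :
    perm_eq [:: p1; p2; p3]
      [:: flip et [:: (a, true, sa); (b, true, sb)];
          flip em [:: (a, false, sa); (c, true, sc)];
          flip eb [:: (b, false, sb); (c, false, sc)]] ->
    triangular_face (u0 ++ p1 ++ u1 ++ p2 ++ u2 ++ p3 ++ u3)
      (size u0).+1 (size u0 + size u1).+3 (size u0 + size u1 + size u2).+4.+1 ->
    code_move (u0 ++ p1 ++ u1 ++ p2 ++ u2 ++ p3 ++ u3)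
      (u0 ++ rev p1 ++ u1 ++ rev p2 ++ u2 ++ rev p3 ++ u3).

Definition diagram_equiv : diagram -> diagram -> Prop :=
  clos_refl_sym_trans diagram (fun D E => code_move (val D) (val E)).

Definition diagram_equivb (D E : diagram) : bool := `[< diagram_equiv D E >].

Fact diagram_equivb_refl : reflexive diagram_equivb.
Proof. by move=> D; apply/asboolP; apply: rst_refl. Qed.

Fact diagram_equivb_sym : symmetric diagram_equivb.
Proof.
by move=> D E; apply/asboolP/asboolP; apply: rst_sym.
Qed.

Fact diagram_equivb_trans : transitive diagram_equivb.
Proof.
by move=> E D F /asboolP DE /asboolP EF; apply/asboolP; apply: rst_trans DE EF.
Qed.

Canonical diagram_equiv_rel :=
  EquivRel diagram_equivb diagram_equivb_refl diagram_equivb_sym diagram_equivb_trans.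

Local Open Scope quotient_scope.

Definition knotoid : Type := {eq_quot diagram_equivb}.

Definition knotoid_inverse (K : knotoid) : knotoid :=
  \pi_knotoid (diagram_inverse (repr K)).

(* Computed on a diagram of K; the choice is immaterial since diagram_aip is
   invariant under the moves. *)
Definition affine_index_polynomial (K : knotoid) : {malg int[int]} :=
  diagram_aip (repr K).

(* Main.v *)
Require Import Defs.
From mathcomp Require Import all_boot all_order all_algebra.
From mathcomp Require Import generic_quotient finmap monalg boolp.
From mathcomp Require Import zify ring.

Set Implicit Arguments.
Unset Strict Implicit.
Unset Printing Implicit Defensive.

Import Defs GRing.Theory.

(* Symmetry. Cut along the diagram, the complement of the two endpoints in the
   sphere has an infinite cyclic cover in which the diagram lifts to an arc running
   through arc k at level - arc_label k. The cover is planar, so the lifted arc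
   separates it: there is a function phi on the lifted regions which jumps exactly
   across the lifted arc. Following a translate of the lifted arc from end to end,
   phi returns to its initial value, so the algebraic intersection number of the
   lifted arc with each of its translates vanishes, which says that the indices
   n_c = w_+(c) satisfy sum_c (t ^ n_c - t ^ - n_c) = 0. As w_K(c) is n_c or - n_c
   according to the sign of c, this is the symmetry of P_K. The function phi is
   found for each nonzero value t != 1 of the variable by linear algebra: the Euler
   characteristic makes the cochain complex regions -> arcs -> crossings, twisted by
   t, exact. Reversing the diagram replaces every weight by its opposite.

   The inverse of a knotoid is computed on another representative, so P_K must also
   be shown invariant. It only depends on the multiset of labelled passages, and in
   a triangular region the rule giving the next side of the region forces the signs
   and directions that make the labels of an Omega3-move match. *)

(** * Vertices, arcs and regions *)

Lemma ltn_partner w i : well_formed w -> (i < size w)%N -> (partner w i < size w)%N.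
Proof. by move=> wf /(partnerP wf)[]. Qed.

Lemma from_left_partner w i : well_formed w -> (i < size w)%N ->
  from_left (letter w (partner w i)) = ~~ from_left (letter w i).
Proof. by move=> wf /(partnerP wf)[]. Qed.

Lemma rotate_incoming w i : (i < size w)%N -> rotate (incoming w i) =
  if from_left (letter w i) then incoming w (partner w i) else outgoing w (partner w i).
Proof. by move=> lt_i; rewrite /rotate /incoming inordK ?ltnS ?(ltnW lt_i) // ltn_eqF. Qed.

Lemma rotate_outgoing w i : (i < size w)%N -> rotate (outgoing w i) =
  if from_left (letter w i) then outgoing w (partner w i) else incoming w (partner w i).
Proof. by move=> lt_i; rewrite /rotate /outgoing inordK ?ltnS. Qed.

Lemma rotate_tail w : rotate (ord0, true) = (ord0, true) :> dart w.
Proof. by []. Qed.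

Lemma rotate_head w : rotate (ord_max, false) = (ord_max, false) :> dart w.
Proof. by rewrite /rotate /= eqxx. Qed.

Lemma dart_false_incoming w (k : 'I_(size w).+1) : (k, false) = incoming w k.
Proof. by rewrite /incoming inord_val. Qed.

Lemma dart_true_outgoing w (k : 'I_(size w).+1) : (0 < k)%N -> (k, true) = outgoing w k.-1.
Proof. by move=> k_gt0; rewrite /outgoing prednK // inord_val. Qed.

Lemma opposite_inj w : injective (@opposite w).
Proof. by apply: inv_inj => -[k b]; rewrite /opposite /= negbK. Qed.

Lemma face_step_inj w : well_formed w -> injective (@face_step w).
Proof. by move=> wf; apply: inj_comp; [exact: rotate_inj | exact: opposite_inj]. Qed.

(** [partner] is an involution exchanging the passages from the left and from the right. *)
Lemma sum_partner (V : nmodType) w (H : nat -> V) : well_formed w ->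
  (\sum_(i < size w | ~~ from_left (letter w i)) H i =
   \sum_(i < size w | from_left (letter w i)) H (partner w i))%R.
Proof.
move=> wf; pose h (i : 'I_(size w)) := Ordinal (ltn_partner wf (ltn_ord i)).
have hK : involutive h by move=> i; apply: val_inj; rewrite /= partnerK.
rewrite (reindex_inj (inv_inj hK)) /=; apply: eq_bigl => i.
by rewrite from_left_partner ?negbK.
Qed.

Lemma card_from_left w : well_formed w ->
  #|[pred i : 'I_(size w) | from_left (letter w i)]|.*2 = size w.
Proof.
move=> wf; have := sum_partner (fun=> 1%N) wf.
rewrite (sum1_card [pred i : 'I_(size w) | ~~ from_left (letter w i)]).
rewrite (sum1_card [pred i : 'I_(size w) | from_left (letter w i)]) => e.
rewrite -addnn -{2}e -[RHS]card_ord -(cardC [pred i : 'I_(size w) | from_left (letter w i)]).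
by congr (_ + _)%N; apply: eq_card => i; rewrite !inE.
Qed.

Lemma order_rotate w (d : dart w) : well_formed w -> rotate d != d ->
  order (@rotate w) d = 4.
Proof.
move=> wf nfix.
suff H i : (i < size w)%N -> from_left (letter w i) ->
    d \in [:: incoming w i; incoming w (partner w i);
              outgoing w i; outgoing w (partner w i)] ->
    order (@rotate w) d = 4.
  (* The crossing may be named by its passage from the left, replacing [i] by its partner if
     necessary. *)
  have H' i : (i < size w)%N -> (d == incoming w i) || (d == outgoing w i) ->
      order (@rotate w) d = 4.
    move=> lt_i hd; have [fl|nfl] := boolP (from_left (letter w i)).
      by apply: (H i) => //; rewrite !inE; case/orP: hd => ->; rewrite ?orbT.
    apply: (H (partner w i)); rewrite ?ltn_partner ?from_left_partner ?partnerK //.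
    by rewrite !inE; case/orP: hd => ->; rewrite ?orbT.
  case: d nfix {H} H' => k [] nfix H'.
    have k_gt0 : (0 < k)%N.
      rewrite lt0n; apply: contraNneq nfix => k0.
      by have -> : k = ord0; [apply: val_inj | rewrite rotate_tail].
    have lt_k : (k.-1 < size w)%N by rewrite prednK // -ltnS ltn_ord.
    by apply: (H' _ lt_k); rewrite dart_true_outgoing ?eqxx ?orbT.
  have lt_k : (k < size w)%N.
    rewrite ltn_neqAle -ltnS ltn_ord andbT; apply: contraNneq nfix => kn.
    by have -> : k = ord_max; [apply: val_inj | rewrite rotate_head].
  by apply: (H' _ lt_k); rewrite dart_false_incoming eqxx.
move=> lt_i fl; set j := partner w i.
have lt_j : (j < size w)%N by apply: ltn_partner.
have fl_j : from_left (letter w j) = false by rewrite from_left_partner // fl.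
have ij : (i == j) = false by apply: contraTF fl => /eqP->; rewrite fl_j.
apply: order_cycle.
  move: (rotate_incoming lt_i) (rotate_incoming lt_j).
  move: (rotate_outgoing lt_i) (rotate_outgoing lt_j).
  rewrite fl fl_j partnerK //.
  move: (incoming w i) (incoming w j) (outgoing w i) (outgoing w j) => p q r s.
  by move=> /= -> -> -> ->; rewrite !eqxx.
by rewrite /= !inE !negb_or !xpair_eqE !andbF !andbT -!val_eqE /=
  !inordK ?ltnS ?(ltnW lt_i) ?(ltnW lt_j) // ?eqSS ij.
Qed.

(** Among the 2(n + 1) darts only those at the tail and the head are fixed; the 2n others fall into
    4-cycles, one per crossing. *)
Lemma fcard_rotate w : well_formed w -> ((fcard (@rotate w) predT).*2 = size w + 4)%N.
Proof.
move=> wf; pose a := [pred d : dart w | rotate d == d].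
have cl_a : fclosed (@rotate w) a.
  by move=> d _ /eqP <-; rewrite !inE (inj_eq (rotate_inj wf)).
have card_a : #|a| = 2.
  rewrite (_ : 2 = #|pred2 ((ord0, true) : dart w) (ord_max, false)|); last first.
    by rewrite card2 xpair_eqE andbF.
  apply: eq_card => d.
  rewrite !inE; apply/idP/orP => [fix_d|[] /eqP ->]; last 2 first.
  - by rewrite rotate_tail.
  - by rewrite rotate_head.
  case: d fix_d => k [] fix_d; [left|right]; rewrite xpair_eqE eqxx andbT.
    apply/eqP/val_inj/eqP; rewrite /= -leqn0 leqNgt; apply: contraTN fix_d => k_gt0.
    have lt_k : (k.-1 < size w)%N by rewrite prednK // -ltnS ltn_ord.
    rewrite dart_true_outgoing // rotate_outgoing //; case: ifP => fl; last first.
      by rewrite xpair_eqE andbF.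
    have lt_p := ltn_partner wf lt_k.
    rewrite xpair_eqE eqxx andbT -val_eqE /= !inordK ?ltnS // eqSS.
    by apply: contraTneq fl => e; have := from_left_partner wf lt_k; rewrite e; case: from_left.
  apply/eqP/val_inj/eqP; rewrite /= eqn_leq -ltnS ltn_ord leqNgt.
  apply: contraTN fix_d => lt_k.
  rewrite dart_false_incoming rotate_incoming //; case: ifP => fl; last first.
    by rewrite xpair_eqE andbF.
  have lt_p := ltn_partner wf lt_k.
  rewrite xpair_eqE eqxx andbT -val_eqE /= !inordK ?ltnS ?(ltnW lt_k) ?(ltnW lt_p) //.
  by apply: contraTneq fl => e; have := from_left_partner wf lt_k; rewrite e; case: from_left.
have sub1 : a \subset order_set (@rotate w) 1.
  apply/subsetP => d; rewrite !inE => fix_d.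
  by apply/eqP/(@order_cycle _ _ [:: d]); rewrite /= ?fix_d ?inE.
have sub4 : [predC a] \subset order_set (@rotate w) 4.
  by apply/subsetP => d; rewrite !inE => nfix; rewrite order_rotate.
have := fcard_order_set (rotate_inj wf) sub1 cl_a.
have := fcard_order_set (rotate_inj wf) sub4 (predC_closed cl_a).
have := cardC a; rewrite card_a card_prod card_ord card_bool (n_compC a).
rewrite -[#|predC a|]/(#|[predC a]|).
move: #|_| (fcard _ [predC a]) (fcard _ a) => x y z; lia.
Qed.

Lemma fcard_opposite w : fcard (@opposite w) predT = (size w).+1.
Proof.
have inj := @opposite_inj w.
have sub : predT \subset order_set (@opposite w) 2.
  apply/subsetP => -[k b] _; rewrite !inE; apply/eqP.
  apply: (@order_cycle _ _ [:: (k, b); (k, ~~ b)]); rewrite ?inE ?eqxx //=.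
    by rewrite /opposite /= negbK !eqxx.
  by rewrite inE xpair_eqE; case: b; rewrite andbF.
have e := fcard_order_set inj sub (fun _ _ _ => erefl).
by apply/eqP; rewrite -(eqn_pmul2r (isT : 0 < 2)) e cardT -cardE card_prod card_ord card_bool.
Qed.

(** Euler's formula with n/2 + 2 vertices and n + 1 arcs leaves n/2 + 1 regions. Sphericity enters
    the proof in this form. *)
Lemma fcard_face_step w : well_formed w -> spherical w ->
  fcard (@face_step w) predT = (#|[pred i : 'I_(size w) | from_left (letter w i)]|).+1.
Proof.
move=> wf /eqP; rewrite fcard_opposite.
have := fcard_rotate wf; have := card_from_left wf.
move: #|_| (fcard _ _) (fcard _ _) => x y z; lia.
Qed.

(** * The potential on the infinite cyclic cover *)

Local Open Scope ring_scope.

Lemma sum_mul_eq (R : pzRingType) (T : finType) (f : T -> R) (j : T) :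
  \sum_i f i * (i == j)%:R = f j.
Proof.
by rewrite (bigD1 j) //= eqxx mulr1 big1 ?addr0 // => i /negbTE->; rewrite mulr0.
Qed.

(** The row space of [A] lies in the left kernel of [B], and both have dimension n - p = m. *)
Lemma exact_mulmx (F : fieldType) m n p (A : 'M[F]_(m, n)) (B : 'M_(n, p)) (v : 'rV_n) :
  n = (m + p)%N -> row_free A -> row_free B^T -> A *m B = 0 -> v *m B = 0 ->
  exists u, v = u *m A.
Proof.
move=> n_mp /eqP rA /eqP rB /sub_kermxP sAB /sub_kermxP vB; apply/submxP.
apply: submx_trans vB _; rewrite -(mxrank_leqif_sup sAB) mxrank_ker.
by rewrite rA -(mxrank_tr B) rB n_mp addnK.
Qed.

Lemma arc_labelS w i : (i < size w)%N ->
  arc_label w i.+1 = arc_label w i + (if from_left (letter w i) then -1 else 1).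
Proof.
by move=> lt_i; rewrite /arc_label (take_nth (0, false, false)%N) // big_rcons.
Qed.

Section Faces.
Variables (w : seq passage) (T : Type) (phi : dart w -> T).
Hypothesis phi_face : forall d, phi (face_step d) = phi d.

(* [face_step] turns right at the end of an arc, so the orbit of the dart (k, true)
   is the region on the right of arc k. *)
Definition left_face (k : nat) : T := phi (inord k, false).
Definition right_face (k : nat) : T := phi (inord k, true).

Lemma right_face_tail : right_face 0 = left_face 0.
Proof.
rewrite /right_face /left_face -(phi_face (_, false)) /face_step /opposite /=.
by rewrite inordK.
Qed.

Lemma right_face_head : right_face (size w) = left_face (size w).
Proof.
rewrite /right_face /left_face -(phi_face (_, true)) /face_step /opposite /=.
by rewrite inordK // eqxx.
Qed.

Lemma right_face_incoming i : (i < size w)%N -> right_face i =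
  if from_left (letter w i) then left_face (partner w i) else right_face (partner w i).+1.
Proof.
move=> lt_i; rewrite /right_face -(phi_face (_, true)) /face_step.
by rewrite [opposite _]/(incoming w i) rotate_incoming //; case: ifP.
Qed.

Lemma left_face_outgoing i : (i < size w)%N -> left_face i.+1 =
  if from_left (letter w i) then right_face (partner w i).+1 else left_face (partner w i).
Proof.
move=> lt_i; rewrite /left_face -(phi_face (_, false)) /face_step.
by rewrite [opposite _]/(outgoing w i) rotate_outgoing //; case: ifP.
Qed.

(** The corners below, left of, above and right of the crossing, each seen from the two arcs that
    bound it. *)
Lemma faces_crossing i : well_formed w -> (i < size w)%N -> from_left (letter w i) ->
  [/\ right_face i = left_face (partner w i),
      left_face (partner w i).+1 = left_face i,
      left_face i.+1 = right_face (partner w i).+1 &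
      right_face (partner w i) = right_face i.+1].
Proof.
move=> wf lt_i fl; have lt_j := ltn_partner wf lt_i.
have := from_left_partner wf lt_i; rewrite fl /= => fl_j.
have := right_face_incoming lt_i; have := right_face_incoming lt_j.
have := left_face_outgoing lt_i; have := left_face_outgoing lt_j.
by rewrite fl fl_j partnerK.
Qed.

End Faces.

(** * The twisted cochain complex of regions, arcs and crossings *)

Section Potential.
Variables (F : fieldType) (t : F) (w : seq passage).
Hypotheses (t_neq0 : t != 0) (t_neq1 : t != 1).
Hypotheses (wf : well_formed w) (sph : spherical w).

Local Notation n := (size w).
Local Notation left_passage := [pred i : 'I_n | from_left (letter w i)].
Local Notation nfaces := #|[predI froots (@face_step w) & predT]|.

Fact froots_face_step : froot (@face_step w) (ord0, true) \in
  [predI froots (@face_step w) & predT].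
Proof. by rewrite !inE roots_root //; apply: fconnect_sym; apply: face_step_inj. Qed.

Definition face_index (d : dart w) : 'I_nfaces :=
  enum_rank_in froots_face_step (froot (@face_step w) d).

Lemma face_index_step d : face_index (face_step d) = face_index d.
Proof.
congr (enum_rank_in _ _); symmetry; apply/eqP.
by rewrite root_connect ?fconnect1 //; apply: fconnect_sym; apply: face_step_inj.
Qed.

Lemma face_index_surj f : exists d, f = face_index d.
Proof.
exists (enum_val f); have := enum_valP f; rewrite !inE andbT => /eqP e.
by rewrite /face_index e enum_valK_in.
Qed.

Local Notation lface := (left_face face_index).
Local Notation rface := (right_face face_index).

(* Passing arc k from left to right leads from level m to level m + 1 of the
   infinite cyclic cover, whence the factor t^-1. *)
Definition coboundary : 'M[F]_(nfaces, n.+1) :=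
  \matrix_(f, k) (t^-1 * (f == rface k)%:R - (f == lface k)%:R).

Lemma mul_coboundary (u : 'rV_nfaces) k :
  (u *m coboundary) 0 k = t^-1 * u 0 (rface k) - u 0 (lface k).
Proof.
rewrite mxE -(sum_mul_eq (fun f => u 0 f)) -(sum_mul_eq (fun f => u 0 f) (lface k)).
rewrite mulr_sumr -sumrB; apply: eq_bigr => f _; rewrite mxE; ring.
Qed.

(** A vector in the kernel is multiplied by [t] from the left to the right of every arc. Both sides
    of the first arc are the same region, so [t != 1] makes it vanish there; the vanishing then
    spreads along the diagram. *)
Lemma coboundary_free : row_free coboundary.
Proof.
apply: inj_row_free => u /rowP u0.
have rl k : (k <= n)%N -> u 0 (rface k) = t * u 0 (lface k).
  move=> le_k; have := u0 (inord k); rewrite mul_coboundary mxE inordK //.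
  by move/eqP; rewrite subr_eq0 => /eqP <-; rewrite mulrA divff ?mul1r.
have lz k : (k <= n)%N -> u 0 (lface k) = 0.
  elim: k => [_|k IH lt_k].
    have := rl 0 isT; rewrite (right_face_tail face_index_step) => /eqP.
    rewrite -subr_eq0 -{1}[u _ _]mul1r -mulrBl mulf_eq0 subr_eq0 eq_sym.
    by rewrite (negbTE t_neq1) => /eqP.
  have {}IH := IH (ltnW lt_k); have lt_p := ltn_partner wf lt_k.
  have [fl|nfl] := boolP (from_left (letter w k)).
    have [e1 e2 e3 e4] := faces_crossing face_index_step wf lt_k fl.
    by rewrite e3 rl // e2 IH mulr0.
  have fl : from_left (letter w (partner w k)) by rewrite from_left_partner.
  have [e1 e2 e3 e4] := faces_crossing face_index_step wf lt_p fl.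
  rewrite partnerK // in e1 e2 e3 e4.
  apply/eqP; rewrite e2 -(mulrI_eq0 _ (mulfI t_neq0)) -rl ?(ltnW lt_p) // e1.
  by rewrite IH.
(* Every region borders some arc, on its left or on its right. *)
apply/rowP => f; have [[k b] ->] := face_index_surj f; rewrite mxE.
have le_k : (k <= n)%N by rewrite -ltnS ltn_ord.
rewrite -(inord_val k); case: b; last exact: lz.
by rewrite -[face_index _]/(rface k) rl // lz // mulr0.
Qed.

(* The two ways around a crossing, from the region on its left to the one on its
   right, give the same total jump. *)
Definition relations : 'M[F]_(n.+1, #|left_passage|) :=
  \matrix_(k, c) let i := val (enum_val c : 'I_n) in let j := partner w i in
    (t * (k == i :> nat)%:R + (k == j :> nat)%:R
     - (k == i.+1 :> nat)%:R - t * (k == j.+1 :> nat)%:R).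

Lemma mul_relations m (X : 'M_(m, n.+1)) f (c : 'I_#|left_passage|)
  (i := val (enum_val c)) (j := partner w i) :
  (X *m relations) f c =
  t * X f (inord i) + X f (inord j) - X f (inord i.+1) - t * X f (inord j.+1).
Proof.
have lt_i : (i < n)%N := ltn_ord _; have lt_j : (j < n)%N by apply: ltn_partner.
have E k : (k <= n)%N -> X f (inord k) = \sum_l X f l * (l == k :> nat)%:R.
  move=> le_k; rewrite -(sum_mul_eq (X f)); apply: eq_bigr => l _.
  by rewrite -val_eqE /= inordK.
rewrite mxE !E ?(ltnW lt_i) ?(ltnW lt_j) // !mulr_sumr -big_split -!sumrB /=.
apply: eq_bigr => l _; rewrite mxE /=; ring.
Qed.

(** Each of the four corners at a crossing occurs twice, with opposite coefficients. *)
Lemma coboundary_relations : coboundary *m relations = 0.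
Proof.
apply/matrixP => f c; rewrite mul_relations !mxE.
have := enum_valP c; rewrite inE; set i := enum_val c => fl.
have lt_i : (i < n)%N := ltn_ord _; have lt_j := ltn_partner wf lt_i.
rewrite !inordK ?ltnS ?(ltnW lt_i) ?(ltnW lt_j) //.
have [-> -> -> ->] := faces_crossing face_index_step wf lt_i fl.
by field.
Qed.

(** Induction along the diagram: the equation at arc [k] involves only the crossings at its two
    ends. The one where it starts has coefficient 0 by induction, and the one where it ends enters
    with the nonzero factor [t] or 1. *)
Lemma relations_free : row_free relations^T.
Proof.
apply: inj_row_free => u /rowP u0.
suff H k (c : 'I_#|left_passage|) : (k < n)%N ->
    k = val (enum_val c) \/ k = partner w (enum_val c) -> u 0 c = 0.
  by apply/rowP => c; rewrite mxE (H (enum_val c)) //; left.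
elim/ltn_ind: k c => k IH c lt_k kc; apply/eqP; apply: contraT => uc.
have := u0 (inord k); rewrite mxE (bigD1 c) //= big1 ?addr0 => [|c' cc']; last first.
  have [->|uc'] := eqVneq (u 0 c') 0; first by rewrite mul0r.
  rewrite !mxE /= inordK ?(leqW lt_k) //.
  have lt_c := ltn_ord (enum_val c); have lt_c' := ltn_ord (enum_val c').
  have fl := enum_valP c; have fl' := enum_valP c'; rewrite !inE in fl fl'.
  have ne : (enum_val c' == enum_val c :> nat) = false.
    by rewrite val_eqE (inj_eq enum_val_inj) (negbTE cc').
  have flj := from_left_partner wf lt_c; have flj' := from_left_partner wf lt_c'.
  have -> : (k == enum_val c') = false.
    case: kc => ->; first by rewrite eq_sym ne.
    by apply: contraTF fl' => /eqP <-; rewrite flj fl.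
  have -> : (k == partner w (enum_val c')) = false.
    case: kc => ->; first by apply: contraTF fl => /eqP ->; rewrite flj' fl'.
    apply: contraFF ne => /eqP e.
    by rewrite -(partnerK wf lt_c) e partnerK.
  have -> : (k == (enum_val c').+1) = false.
    apply: contraNF uc' => /eqP e.
    by rewrite (IH (enum_val c')) // ?e //; left.
  have -> : (k == (partner w (enum_val c')).+1) = false.
    apply: contraNF uc' => /eqP e.
    by rewrite (IH (partner w (enum_val c'))) // ?e ?ltn_partner //; right.
  by rewrite !(mulr0, addr0, subr0).
rewrite !mxE /= inordK ?(leqW lt_k) //.
have lt_c := ltn_ord (enum_val c); have fl := enum_valP c; rewrite inE in fl.
have flj := from_left_partner wf lt_c; rewrite fl in flj.
have -> : (k == (enum_val c).+1) = false.
  apply: contraNF uc => /eqP e.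
  by rewrite (IH (enum_val c)) // ?e //; left.
have -> : (k == (partner w (enum_val c)).+1) = false.
  apply: contraNF uc => /eqP e.
  by rewrite (IH (partner w (enum_val c))) // ?e ?ltn_partner //; right.
have ij : (enum_val c == partner w (enum_val c) :> nat) = false.
  by apply: contraTF fl => /eqP->; rewrite flj.
case: kc => ->; rewrite eqxx ?ij 1?eq_sym ?ij /= !(mulr0, mulr1, subr0, addr0, add0r) => /eqP.
  by rewrite mulf_eq0 (negbTE uc) (negbTE t_neq0).
by rewrite (negbTE uc).
Qed.

(** The lifted arc defines the cochain [v], which satisfies the relations at the crossings; by
    exactness it is a coboundary. *)
Lemma potential_exists : exists phi : dart w -> F,
  (forall d, phi (face_step d) = phi d) /\
  forall k, (k <= n)%N ->
    t^-1 * right_face phi k - left_face phi k = t ^ (- arc_label w k).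
Proof.
pose v : 'rV[F]_n.+1 := \row_k t ^ (- arc_label w k).
have vB : v *m relations = 0.
  apply/matrixP => z c; rewrite mul_relations !mxE.
  have := enum_valP c; rewrite inE; set i := enum_val c => fl.
  have lt_i : (i < n)%N := ltn_ord _; have lt_j := ltn_partner wf lt_i.
  have flj := from_left_partner wf lt_i; rewrite fl in flj.
  rewrite !inordK ?ltnS ?(ltnW lt_i) ?(ltnW lt_j) //.
  rewrite !arc_labelS // fl flj /= !opprD opprK !expfzDr // !exprN1 expr1z.
  by field.
have dims : n.+1 = (nfaces + #|left_passage|)%N.
  rewrite -[nfaces]/(fcard (@face_step w) predT) fcard_face_step //.
  by rewrite addSn addnn card_from_left.
have [u vE] := exact_mulmx dims coboundary_free relations_free coboundary_relations vB.
exists (fun d => u 0 (face_index d)); split=> [d|k le_k]; first by rewrite face_index_step.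
by move/rowP: vE => /(_ (inord k)); rewrite mul_coboundary mxE inordK.
Qed.

Lemma sum_index_powers :
  \sum_(i < n | from_left (letter w i))
    (t ^ (arc_label w i - arc_label w (partner w i) - 1) -
     t ^ (- (arc_label w i - arc_label w (partner w i) - 1))) = 0.
Proof.
have [phi [phi_face phiE]] := potential_exists.
(* The potential on the left of arc [k], rescaled to follow one translate of the lifted arc through
   its changes of level. *)
pose G k := left_face phi k * t ^ arc_label w k.
have t1 : t^-1 - 1 != 0 by rewrite subr_eq0 invr_eq1.
(* At the tail and at the head both sides of the arc are one region, so the jump determines [G],
   with the same value at both. *)
have GE k : (k <= n)%N -> right_face phi k = left_face phi k -> G k = (t^-1 - 1)^-1.
  move=> le_k e; have := phiE k le_k; rewrite e -{2}[left_face _ _]mul1r -mulrBl => e1.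
  rewrite /G -[left_face phi k](mulKf t1) e1 -mulrA -expfzDr // addNr.
  by rewrite expr0z mulr1.
have : \sum_(i < n) (G i.+1 - G i) = 0.
  rewrite -(big_mkord xpredT (fun i => G i.+1 - G i)) telescope_sumr //.
  by rewrite !GE ?subrr // ?(right_face_tail phi_face) ?(right_face_head phi_face).
rewrite (bigID (fun i : 'I_n => from_left (letter w i))) /=.
rewrite (sum_partner (fun i => G i.+1 - G i)) // -big_split /= => S0.
rewrite -[RHS]S0; apply: eq_bigr => i fl.
have lt_i := ltn_ord i; have lt_j := ltn_partner wf lt_i.
have flj := from_left_partner wf lt_i; rewrite fl in flj.
have [e1 e2 e3 e4] := faces_crossing phi_face wf lt_i fl.
have := phiE i (ltnW lt_i); have := phiE (partner w i).+1 lt_j.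
rewrite /G !arc_labelS // fl flj e1 e2 e3 => E1 E2.
(* Expressed through the region on the left of the crossing, the potential cancels and only the two
   powers of [t] remain. *)
have -> : right_face phi (partner w i).+1 =
    t * (left_face phi i + t ^ (- (arc_label w (partner w i) + 1))).
  by rewrite -E1; field.
have -> : left_face phi (partner w i) = t * (left_face phi i + t ^ (- arc_label w i)).
  by rewrite -E2; field.
rewrite !opprD ?opprK !expfzDr // !exprN1 -!invr_expz !expr1z.
have := t_neq0; move: (arc_label w i) (arc_label w (partner w i)) => a b _.
have ta : t ^ a != 0 by rewrite expfz_eq0 negb_and t_neq0 orbT.
have tb : t ^ b != 0 by rewrite expfz_eq0 negb_and t_neq0 orbT.
by field; rewrite ta tb t_neq0.
Qed.

End Potential.

(** * Symmetry and reversal *)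

(** The identity is taken at the indeterminate of the fraction field of Z[X], where coefficients can
    be compared. *)
Lemma balanced_exponents (I : finType) (P : pred I) (n : I -> int) (m : int) :
  (forall (F : fieldType) (t : F), t != 0 -> t != 1 ->
     \sum_(i | P i) (t ^ n i - t ^ (- n i)) = 0) ->
  \sum_(i | P i) ((n i == m)%:R - (n i == - m)%:R) = 0 :> int.
Proof.
suff H (F : fieldType) (iota : {rmorphism {poly int} -> F}) : injective iota ->
    (forall t : F, t != 0 -> t != 1 -> \sum_(i | P i) (t ^ n i - t ^ (- n i)) = 0) ->
    \sum_(i | P i) ((n i == m)%:R - (n i == - m)%:R) = 0 :> int.
  move=> /(_ {fraction {poly int}}); apply: (H _ (@FracField.tofrac {poly int})).
  by move=> p q /eqP; rewrite tofrac_eq => /eqP.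
move=> iota_inj; set x := iota 'X.
have x0 : x != 0 by rewrite -(rmorph0 iota) (inj_eq iota_inj) polyX_eq0.
have x1 : x != 1.
  rewrite -(rmorph1 iota) (inj_eq iota_inj).
  by apply/eqP => /(congr1 (fun p : {poly int} => size p)); rewrite size_polyX size_poly1.
move=> /(_ x x0 x1) S0.
(* Multiplying by X^M makes all exponents nonnegative, so [absz] does not alter them; the
   coefficient of degree M + m is then read off. *)
pose M := (`|m| + \sum_i `|n i|)%N.
have leM i : (`|n i| <= M)%N.
  by rewrite /M (bigD1 i) //= addnCA leq_addr.
have lem : (`|m| <= M)%N by apply: leq_addr.
have : \sum_(i | P i) ('X^(absz (M%:Z + n i)) - 'X^(absz (M%:Z - n i))) = 0 :> {poly int}.
  apply: iota_inj; rewrite rmorph0 rmorph_sum /=.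
  transitivity (x ^ M%:Z * \sum_(i | P i) (x ^ n i - x ^ (- n i))).
    rewrite mulr_sumr; apply: eq_bigr => i _; have le_i := leM i.
    rewrite rmorphB !rmorphXn mulrBr -!expfzDr // !exprnP.
    by congr (_ ^ _ - _ ^ _); lia.
  by rewrite S0 mulr0.
move/(congr1 (fun p : {poly int} => p`_(absz (M%:Z + m)))); rewrite coef0 coef_sum => S1.
rewrite -[RHS]S1; apply: eq_bigr => i _; have le_i := leM i; rewrite coefB !coefXn.
by congr (_%:R - _%:R); congr nat_of_bool; apply/eqP/eqP; lia.
Qed.

(* The number w_+ of the crossing whose left incoming arc is arc i, whatever its sign. *)
Definition crossing_index (w : seq passage) (i : nat) : int :=
  arc_label w i - arc_label w (partner w i) - 1.

Lemma weightE w i : weight w i = crossing_index w i * crossing_sign (letter w i).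
Proof. by rewrite /weight /crossing_sign /crossing_index; case: positive; ring. Qed.

Lemma mcoeff_subst_inv (p : {malg int[int]}) m : (subst_inv p)@_m = p@_(- m).
Proof.
rewrite [in RHS](monalgE p) /subst_inv !raddf_sum /=; apply: eq_bigr => n _.
by rewrite !mcoeffU eqr_oppLR.
Qed.

Lemma mcoeff_code_aip w m : (code_aip w)@_m =
  \sum_(i < size w | from_left (letter w i))
    ((weight w i == m)%:R - (0 == m)%:R) *~ crossing_sign (letter w i).
Proof.
rewrite /code_aip raddf_sum /=; apply: eq_bigr => i _.
by rewrite raddfMz /= mcoeffB !mcoeffU.
Qed.

Lemma subst_inv_code_aip w : well_formed w -> spherical w ->
  subst_inv (code_aip w) = code_aip w.
Proof.
move=> wf sph; apply/malgP => m; rewrite mcoeff_subst_inv !mcoeff_code_aip.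
apply/esym/eqP; rewrite -subr_eq0 -sumrB; apply/eqP.
rewrite -[RHS](@balanced_exponents _ (fun i : 'I_(size w) => from_left (letter w i))
  (fun i => crossing_index w i) m).
  (* A negative crossing has weight [- k] and sign -1; the two changes compensate, so the
     contribution is the same for both signs. *)
  apply: eq_bigr => i _; rewrite weightE /crossing_sign; set k := crossing_index w i.
  have -> : (0 == - m) = (0 == m) by apply/eqP/eqP; lia.
  case: positive; first by rewrite mulr1 !mulr1z; ring.
  have -> : (k * -1 == m) = (k == - m) by apply/eqP/eqP; lia.
  have -> : (k * -1 == - m) = (k == m) by apply/eqP/eqP; lia.
  by rewrite !mulrN1z; ring.
by move=> F t t0 t1; apply: sum_index_powers.
Qed.

(** * Labels and indices of the reversed diagram *)

Lemma arc_label_size w : well_formed w -> arc_label w (size w) = 0.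
Proof.
move=> wf; have e : arc_label w (size w) =
    \sum_(i < size w) (if from_left (letter w i) then -1 else 1).
  by rewrite /arc_label take_size (big_nth (0, false, false)%N) big_mkord.
rewrite e (bigID (fun i : 'I_(size w) => from_left (letter w i))) /=.
rewrite (sum_partner (fun i => if from_left (letter w i) then -1 else 1 : int)) //.
rewrite -big_split big1 //= => i fl.
by rewrite from_left_partner // fl.
Qed.

Lemma arc_label_rev w k : well_formed w -> (k <= size w)%N ->
  arc_label (rev w) k = - arc_label w (size w - k).
Proof.
move=> wf le_k; apply/eqP; rewrite -subr_eq0 opprK -(arc_label_size wf).
rewrite {1 2}/arc_label take_rev big_rev /= addrC -big_cat cat_take_drop.
by rewrite /arc_label take_size.
Qed.

(** The incoming arcs of the reversed crossing are the former outgoing ones, labelled a - 1 and b +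
    1 before the change of sign; and -(a - 1) + (b + 1) - 1 = -(a - b - 1). *)
Lemma crossing_index_rev w i : well_formed w -> (i < size w)%N -> from_left (letter w i) ->
  crossing_index (rev w) (size w - i.+1) = - crossing_index w i.
Proof.
move=> wf lt_i fl; have lt_p := ltn_partner wf lt_i.
have flp := from_left_partner wf lt_i; rewrite fl in flp.
have lt_i' := mirror_lt lt_i.
rewrite /crossing_index partner_rev // mirrorK // !arc_label_rev ?leq_subr //.
rewrite !subKn // !arc_labelS // fl flp /=; ring.
Qed.

Lemma code_aip_rev w : well_formed w -> code_aip (rev w) = subst_inv (code_aip w).
Proof.
move=> wf; apply/malgP => m; rewrite mcoeff_subst_inv !mcoeff_code_aip.
pose h (i : 'I_(size w)) := rev_ord i.
rewrite size_rev (reindex_inj rev_ord_inj) /=.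
apply: eq_big => [i|i]; rewrite letter_rev ?mirror_lt // mirrorK // => fl.
rewrite !weightE crossing_index_rev // letter_rev ?mirror_lt // mirrorK //.
have -> : (0 == - m) = (0 == m) by apply/eqP/eqP; lia.
by rewrite mulNr eqr_oppLR.
Qed.

(** * Labelled passages and the moves *)

Definition sign (e : bool) : int := if e then 1 else -1.

Lemma signN e : sign (~~ e) = - sign e.
Proof. by case: e. Qed.

Lemma sign_sqr e : sign e * sign e = 1.
Proof. by case: e. Qed.

Definition jump (x : passage) : int := if from_left x then -1 else 1.

Lemma jumpE c o e : jump (c, o, e) = - (sign o * sign e).
Proof. by case: o; case: e. Qed.

Definition rise (w : seq passage) : int := \sum_(x <- w) jump x.

(** Each passage carries the label of its incoming arc, so that moves can be compared without
    tracking positions. *)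
Fixpoint labelled (a : int) (w : seq passage) : seq (passage * int) :=
  if w is x :: w' then (x, a) :: labelled (a + jump x) w' else [::].

Lemma labelled_cat a u v : labelled a (u ++ v) = labelled a u ++ labelled (a + rise u) v.
Proof.
elim: u a => [|x u IH] a /=; first by rewrite /rise big_nil addr0.
by rewrite IH /rise big_cons addrA.
Qed.

Lemma rise_pair p q : rise [:: p; q] = jump p + jump q.
Proof. by rewrite /rise !big_cons big_nil addr0. Qed.

Lemma rise_rev u : rise (rev u) = rise u.
Proof. exact: big_rev. Qed.

Lemma unzip1_labelled a w : unzip1 (labelled a w) = w.
Proof. by elim: w a => //= x w IH a; rewrite IH. Qed.

Lemma labelledE a w :
  labelled a w = [seq (letter w i, a + arc_label w i) | i <- iota 0 (size w)].
Proof.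
elim: w a => //= x w IH a; congr (_ :: _).
  by rewrite /letter /arc_label /= big_nil addr0.
rewrite IH -[1%N]addn0 iotaDl -map_comp; apply: eq_map => i /=.
by rewrite /arc_label /= big_cons addrA.
Qed.

Definition matching (x y : passage) : bool :=
  (crossing y == crossing x) && (over y != over x).

Definition pair_term (p q : passage * int) : {malg int[int]} :=
  (<< (p.2 - q.2 - 1) * crossing_sign p.1 >> - << 0 >>) *~ crossing_sign p.1.

(** The polynomial as a function of the multiset of labelled passages: the inner sum looks for the
    partner by name instead of by position. *)
Definition pairing (s : seq (passage * int)) : {malg int[int]} :=
  \sum_(p <- s | from_left p.1) \sum_(q <- s | matching p.1 q.1) pair_term p q.

Lemma code_aip_pairing w : well_formed w -> code_aip w = pairing (labelled 0 w).
Proof.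
move=> wf; have E : iota 0 (size w) = index_iota 0 (size w) by rewrite /index_iota subn0.
rewrite /pairing labelledE E big_map /= big_mkord.
apply: eq_bigr => i _; rewrite big_map big_mkord.
have lt_p := ltn_partner wf (ltn_ord i).
have [_ e1 e2 _] := partnerP wf (ltn_ord i).
rewrite (big_pred1 (Ordinal lt_p)) => [|j] /=.
  by rewrite weightE /pair_term /crossing_index /= !add0r.
rewrite /matching; apply/andP/eqP => [[/eqP f1 f2]|->]; last first.
  by rewrite /= e1 e2 eqxx; case: over.
apply: val_inj => /=; apply/esym/partner_uniq => //.
by move: f2; case: over; case: over.
Qed.

Lemma perm_pairing s s' : perm_eq s s' -> pairing s = pairing s'.
Proof.
move=> e; rewrite /pairing (perm_big _ e); apply: eq_bigr => p _.
exact: perm_big e.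
Qed.

Definition key (p : passage * int) : nat * bool := (crossing p.1, over p.1).

Lemma sum_matched_pair (V : nmodType) (T : Type) (P : pred T) (R : rel T)
    (g : T -> T -> V) x y :
  R x x = false -> R x y -> R y x -> R y y = false -> P y = ~~ P x ->
  \sum_(p <- [:: x; y] | P p) \sum_(q <- [:: x; y] | R p q) g p q =
  if P x then g x y else g y x.
Proof.
move=> xx xy yx yy e; rewrite unlock /= xx xy yx yy e.
by case: (P x) => /=; rewrite !addr0.
Qed.

(** The term of a crossing of sign [e], where [d] is the label of its over passage minus that of its
    under passage; the weight is [d - sign e] for both signs. *)
Definition pair_aip (e : bool) (d : int) : {malg int[int]} :=
  (<< d - sign e >> - << 0 >>) *~ sign e.

Lemma pairing_pair c o e a b :
  pairing [:: ((c, o, e), a); ((c, ~~ o, e), b)] =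
  pair_aip e (sign o * (a - b)).
Proof.
rewrite /pairing (@sum_matched_pair _ _
  (fun p => from_left p.1) (fun p q => matching p.1 q.1)).
- rewrite /pair_aip /pair_term /from_left /crossing_sign /over /positive /sign /=.
  by case: o => []; case: e => [] /=; congr ((<< _ >> - _) *~ _); ring.
- by rewrite /matching eqxx /= eqxx.
- by rewrite /matching /crossing /over /= eqxx; case: o.
- by rewrite /matching /crossing /over /= eqxx; case: o.
- by rewrite /matching eqxx /= eqxx.
- by rewrite /from_left /over /positive /=; case: o e => [] [].
Qed.

Lemma pairing_cat s s' :
  (forall p q, p \in s -> q \in s' -> crossing p.1 != crossing q.1) ->
  pairing (s ++ s') = pairing s + pairing s'.
Proof.
move=> dis; rewrite /pairing big_cat; congr (_ + _).
  rewrite big_seq_cond [RHS]big_seq_cond; apply: eq_bigr => p /andP[ps _].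
  rewrite big_cat /= [X in _ + X]big1_seq ?addr0 // => q /andP[/andP[/eqP e _] qs].
  by have := dis p q ps qs; rewrite e eqxx.
rewrite big_seq_cond [RHS]big_seq_cond; apply: eq_bigr => q /andP[qs _].
rewrite big_cat /= [X in X + _]big1_seq ?add0r // => p /andP[/andP[/eqP e _] ps].
by have := dis p q ps qs; rewrite e eqxx.
Qed.

Lemma pairing_cat_pair s c o e a b :
  uniq (map key (s ++ [:: ((c, o, e), a); ((c, ~~ o, e), b)])) ->
  pairing (s ++ [:: ((c, o, e), a); ((c, ~~ o, e), b)]) =
  pairing s + pair_aip e (sign o * (a - b)).
Proof.
rewrite map_cat cat_uniq => /and3P[_ /= dis _]; rewrite pairing_cat ?pairing_pair //.
have fresh p : p \in s -> crossing p.1 != c.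
  move=> ps; apply: contraNN dis => /eqP e1; have := map_f key ps; rewrite /key /= e1.
  rewrite /crossing /over /= orbF; move: (p.1.1.2).
  by case: o => [] [] ->; rewrite ?orbT.
by move=> p q ps; rewrite !inE => /orP[] /eqP ->; apply: fresh.
Qed.

Lemma uniq_key_labelled w s : well_formed w -> perm_eq (labelled 0 w) s ->
  uniq (map key s).
Proof.
case/andP=> uw _ /(perm_map key)/perm_uniq <-.
by move: uw; rewrite -{1}(unzip1_labelled 0 w) -map_comp.
Qed.

(** * Invariance under Omega1 and Omega2 *)

(** The jumps of the loop cancel, so the other labels are unchanged, and the new crossing has weight
    0. *)
Lemma code_aip_Omega1 u v c o s :
  well_formed (u ++ v) -> well_formed (u ++ [:: (c, o, s); (c, ~~ o, s)] ++ v) ->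
  code_aip (u ++ v) = code_aip (u ++ [:: (c, o, s); (c, ~~ o, s)] ++ v).
Proof.
move=> wf wf'; rewrite !code_aip_pairing //.
set x := (c, o, s); set y := (c, ~~ o, s).
have jxy : jump x + jump y = 0 by rewrite !jumpE signN; ring.
have e : perm_eq (labelled 0 (u ++ [:: x; y] ++ v))
    (labelled 0 (u ++ v) ++ [:: (x, rise u); (y, rise u + jump x)]).
  by rewrite !labelled_cat rise_pair jxy !add0r addr0 -catA perm_cat2l perm_catC.
rewrite (perm_pairing e) pairing_cat_pair ?(uniq_key_labelled wf' e) //.
rewrite /pair_aip (_ : _ - sign s = 0) ?subrr ?mul0rz ?addr0 //.
by rewrite jumpE opprD addrA subrr add0r opprK mulrA sign_sqr mul1r subrr.
Qed.

Lemma perm_labelled_flip a e p q : perm_eq (labelled a (flip e [:: p; q]))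
  [:: (p, a + if e then jump q else 0); (q, a + if e then 0 else jump p)].
Proof.
by case: e; rewrite /flip ?rev_cons /= addr0 // (perm_catC [:: _] [:: _]).
Qed.

Lemma rise_flip e p q : rise (flip e [:: p; q]) = jump p + jump q.
Proof.
by rewrite /flip; case: e; rewrite ?rise_rev rise_pair.
Qed.

(** Each inserted pair has total jump 0, and the two new crossings have equal weights and opposite
    signs. *)
Lemma code_aip_Omega2 u1 u2 u3 c d o s e
  (w := u1 ++ u2 ++ u3)
  (w' := u1 ++ [:: (c, o, s); (d, o, ~~ s)] ++ u2 ++
         flip e [:: (c, ~~ o, s); (d, ~~ o, ~~ s)] ++ u3) :
  well_formed w -> well_formed w' -> code_aip w = code_aip w'.
Proof.
rewrite /w' => wf wf'; rewrite !code_aip_pairing //.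
pose a := rise u1; pose b := a + rise u2.
set cx := (c, o, s); set dx := (d, o, ~~ s).
set cy := (c, ~~ o, s); set dy := (d, ~~ o, ~~ s).
have jx : jump cx + jump dx = 0 by rewrite !jumpE signN; ring.
have jy : jump cy + jump dy = 0 by rewrite !jumpE !signN; ring.
have e1 : perm_eq (labelled 0 (u1 ++ [:: cx; dx] ++ u2 ++ flip e [:: cy; dy] ++ u3))
   ((labelled 0 w ++
    [:: (cx, a); (cy, b + if e then jump dy else 0)]) ++
    [:: (dx, a + jump cx); (dy, b + if e then 0 else jump cy)]).
  rewrite /w !labelled_cat !add0r rise_flip rise_pair jx jy !addr0.
  rewrite -/a -/b; apply/permP => P; have /permP ef := perm_labelled_flip b e cy dy.
  rewrite !count_cat ef /=; ring.
rewrite (perm_pairing e1) pairing_cat_pair ?(uniq_key_labelled wf' e1) //.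
have := uniq_key_labelled wf' e1; rewrite map_cat cat_uniq => /and3P[u' _ _].
rewrite pairing_cat_pair // -addrA.
rewrite /pair_aip !signN !jumpE !signN; set A := sign o * _ - _; set B := sign o * _ - _.
suff -> : A = B by rewrite mulrNz subrr addr0.
by rewrite /A /B; case: (e); case: (o); rewrite /sign; ring.
Qed.

(** * Invariance under Omega3 and relabelling *)

Lemma perm_unzip1 (S T : eqType) (s : seq (S * T)) (r : seq S) : perm_eq (unzip1 s) r ->
  exists2 s', perm_eq s s' & unzip1 s' = r.
Proof.
case: s => [|p s]; first by rewrite perm_sym => /perm_nilP ->; exists [::].
rewrite perm_sym => /(perm_iotaP p.1)[Is pI ->].
exists [seq nth p (p :: s) i | i <- Is].
  rewrite perm_sym -[X in perm_eq _ X](mkseq_nth p).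
  by rewrite perm_map // (perm_trans pI) // size_map.
rewrite /unzip1 -map_comp; apply/eq_in_map => i.
rewrite (perm_mem pI) mem_iota size_map add0n => lt_i.
exact/esym/(nth_map p p.1 fst lt_i).
Qed.

Lemma flip_flip r e p q : flip r (flip e [:: p; q]) = flip (r (+) e) [:: p; q].
Proof. by case: r; case: e. Qed.

Lemma rise_flip_seq r u : rise (flip r u) = rise u.
Proof. by case: r; rewrite //= rise_rev. Qed.

(** Reversing a pair keeps its total jump, so only labels inside the three pairs change. With [x],
    [y], [z] the labels at the start of the top, middle and bottom pairs, the arguments of [G] are
    the over-minus-under differences at [a], [b], [c], before ([r] false) and after ([r] true) the
    move. *)
Lemma code_aip_triangle u0 u1 u2 u3 p1 p2 p3 a b c sa sb sc et em eb
  (w := fun r => u0 ++ flip r p1 ++ u1 ++ flip r p2 ++ u2 ++ flip r p3 ++ u3)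
  (aT := (a, true, sa)) (bT := (b, true, sb)) (aM := (a, false, sa)) (cM := (c, true, sc))
  (bB := (b, false, sb)) (cB := (c, false, sc)) :
  perm_eq [:: p1; p2; p3] [:: flip et [:: aT; bT]; flip em [:: aM; cM]; flip eb [:: bB; cB]] ->
  exists (G : int -> int -> int -> {malg int[int]}) x y z, forall r, well_formed (w r) ->
    code_aip (w r) = G
      (x + (if r (+) et then jump bT else 0) - (y + if r (+) em then jump cM else 0))
      (x + (if r (+) et then 0 else jump aT) - (z + if r (+) eb then jump cB else 0))
      (y + (if r (+) em then 0 else jump aM) - (z + if r (+) eb then 0 else jump bB)).
Proof.
pose l1 := rise u0; pose l2 := l1 + rise p1 + rise u1; pose l3 := l2 + rise p2 + rise u2.
(* Each pair takes its starting label along when the three are sorted into top, middle and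
   bottom. *)
rewrite -[[:: p1; _; _]]/(unzip1 [:: (p1, l1); (p2, l2); (p3, l3)]) => /perm_unzip1[ps].
case: ps => [|[q1 x] [|[q2 y] [|[q3 z] [|]]]] // pe [] e1 e2 e3.
pose s := labelled 0 u0 ++ labelled (l1 + rise p1) u1 ++ labelled (l2 + rise p2) u2 ++
  labelled (l3 + rise p3) u3.
exists (fun ka kb kc => pairing s + pair_aip sa ka + pair_aip sb kb + pair_aip sc kc), x, y, z.
move=> r wf.
have pw : perm_eq (labelled 0 (w r)) (((s ++
    [:: (aT, x + if r (+) et then jump bT else 0);
        (aM, y + if r (+) em then jump cM else 0)]) ++
    [:: (bT, x + if r (+) et then 0 else jump aT);
        (bB, z + if r (+) eb then jump cB else 0)]) ++
    [:: (cM, y + if r (+) em then 0 else jump aM);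
        (cB, z + if r (+) eb then 0 else jump bB)]).
  rewrite /w !labelled_cat !rise_flip_seq add0r -/l1 -/l2 -/l3.
  apply/permP => P.
  have /permP/(_ P) fx := perm_labelled_flip x (r (+) et) aT bT.
  have /permP/(_ P) fy := perm_labelled_flip y (r (+) em) aM cM.
  have /permP/(_ P) fz := perm_labelled_flip z (r (+) eb) bB cB.
  pose g (q : seq passage * int) := labelled q.2 (flip r q.1).
  have /permP/(_ P) := perm_flatten (perm_map g pe).
  rewrite /g e1 e2 e3 /= !flip_flip !count_cat fx fy fz /= !addn0 => E.
  move: E; do 7 move: (count _ _); do 6 move: (nat_of_bool _).
  move=> {fx fy fz}; lia.
rewrite code_aip_pairing // (perm_pairing pw).
have u1' := uniq_key_labelled wf pw.
have u2' := u1'; rewrite map_cat cat_uniq in u2'; case/andP: u2' => u2' _.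
have u3' := u2'; rewrite map_cat cat_uniq in u3'; case/andP: u3' => u3' _.
rewrite (pairing_cat_pair u1') (pairing_cat_pair u2') (pairing_cat_pair u3').
by rewrite /sign !mul1r.
Qed.

(** Labels ignore the names of crossings, and [matching] only tests them for equality. *)
Lemma code_aip_relabel f w : injective f ->
  well_formed w -> well_formed [seq (f (crossing x), over x, positive x) | x <- w] ->
  code_aip w = code_aip [seq (f (crossing x), over x, positive x) | x <- w].
Proof.
move=> f_inj wf wf'; rewrite !code_aip_pairing //; set g := fun x : passage => _.
have -> a : labelled a (map g w) = [seq (g p.1, p.2) | p <- labelled a w].
  by elim: w {wf wf'} a => //= x w IH a; rewrite IH.
rewrite /pairing big_map; apply: eq_big => // p _; rewrite big_map; apply: eq_bigl => q.
by rewrite /matching /crossing /over /= (inj_eq f_inj).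
Qed.

(** A dart is read as its arc walked from the dart's own end to the other one, forward iff [d.2];
    arc [k] joins the passages at positions [k.-1] and [k]. *)
Definition source w (d : dart w) : nat := if d.2 then d.1.-1 else d.1.
Definition target w (d : dart w) : nat := if d.2 then d.1 : nat else d.1.-1.

(** Neighbours in the cyclic order at a crossing lie on different strands; the right turn reverses
    the direction of walking exactly when the strand met comes from the left. *)
Lemma face_step_crossing w (d : dart w) : well_formed w -> (0 < d.1 < size w)%N ->
  let x := letter w (target d) in let y := letter w (source (face_step d)) in
  [/\ crossing y = crossing x, over y = ~~ over x &
      (face_step d).2 = d.2 (+) from_left x].
Proof.
case: d => k b wf /andP[/= k_gt0 lt_k].
suff [e1 e2] : source (face_step (k, b)) = partner w (target (k, b)) /\
    (face_step (k, b)).2 = b (+) from_left (letter w (target (k, b))).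
  rewrite e1; have [|_ e3 e4 _] := @partnerP w (target (k, b)) wf; last by split.
  by rewrite /target /=; case: b {e1 e2} => //; rewrite prednK // ltnW.
rewrite /face_step /source /target /opposite; case: b => /=.
  have lt_p := ltn_partner wf lt_k; rewrite ltn_eqF //.
  by case: from_left; rewrite /= inordK ?ltnS ?(ltnW lt_p).
have lt_k' : (k.-1 < size w)%N by rewrite prednK // ltnW.
have lt_p := ltn_partner wf lt_k'; rewrite gtn_eqF //.
by case: from_left; rewrite /= inordK ?ltnS ?(ltnW lt_p).
Qed.

Lemma perm_flip e u : perm_eq (flip e u) u.
Proof. by case: e => //=; rewrite perm_rev. Qed.

Lemma perm_eq3 (T : eqType) (x1 x2 x3 y1 y2 y3 : T) :
  perm_eq [:: x1; x2; x3] [:: y1; y2; y3] ->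
  [\/ [/\ x1 = y1, x2 = y2 & x3 = y3] \/ [/\ x1 = y1, x2 = y3 & x3 = y2],
      [/\ x1 = y2, x2 = y1 & x3 = y3] \/ [/\ x1 = y2, x2 = y3 & x3 = y1] |
      [/\ x1 = y3, x2 = y1 & x3 = y2] \/ [/\ x1 = y3, x2 = y2 & x3 = y1]].
Proof.
case/(perm_iotaP y1) => Is; rewrite -mem_permutations.
have -> : permutations (iota 0 3) =
  [:: [:: 1; 0; 2]; [:: 0; 1; 2]; [:: 2; 0; 1];
      [:: 0; 2; 1]; [:: 1; 2; 0]; [:: 2; 1; 0]]%N by [].
rewrite !inE => pI eI.
by case/predU1P: pI eI =>
  [->|/predU1P[->|/predU1P[->|/predU1P[->|/predU1P[->|/eqP ->]]]]] [-> -> ->];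
  [constructor 2; left | constructor 1; left | constructor 3; left
  | constructor 1; right | constructor 2; right | constructor 3; right].
Qed.

Lemma flip_pair_eq b e (s t p q : passage) : flip (~~ b) [:: s; t] = flip e [:: p; q] ->
  s = (if b (+) e then p else q) /\ t = (if b (+) e then q else p).
Proof. by case: b e => [] [] [-> ->]. Qed.

(* A triangle is walked along its sides 1, 2, 3: side j goes from the passage s_j to
   the passage t_j, forward iff b_j. *)
Lemma triangle_signs a b c sa sb sc et em eb (b1 b2 b3 : bool) (s1 s2 s3 t1 t2 t3 : passage) :
  a != b -> a != c -> b != c ->
  perm_eq [:: flip (~~ b1) [:: s1; t1]; flip (~~ b2) [:: s2; t2]; flip (~~ b3) [:: s3; t3]]
    [:: flip et [:: (a, true, sa); (b, true, sb)];
        flip em [:: (a, false, sa); (c, true, sc)];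
        flip eb [:: (b, false, sb); (c, false, sc)]] ->
  [/\ crossing s2 = crossing t1, over s2 = ~~ over t1 & b2 = b1 (+) from_left t1] ->
  [/\ crossing s3 = crossing t2, over s3 = ~~ over t2 & b3 = b2 (+) from_left t2] ->
  [/\ crossing s1 = crossing t3, over s1 = ~~ over t3 & b1 = b3 (+) from_left t3] ->
  et (+) em = sb (+) sc /\ et (+) eb = sa (+) sc.
Proof.
move=> /eqP ab /eqP ac /eqP bc pq [c2 _ B2] [c3 _ B3] [c1 _ B1].
(* Six ways to match sides with strands, each with its directions: the crossings met at the corners
   exclude the incompatible ones, and the rest is a finite boolean check. *)
case/perm_eq3: pq => -[] [/flip_pair_eq[e1 f1] /flip_pair_eq[e2 f2] /flip_pair_eq[e3 f3]];
  rewrite {}e1 {}e2 {}e3 {}f1 {}f2 {}f3 in c1 c2 c3 B1 B2 B3;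
  move: c1 c2 c3 B1 B2 B3;
  case E1: (b1 (+) _); case E2: (b2 (+) _); case E3: (b3 (+) _);
  rewrite /crossing /= => c1 c2 c3; try (by exfalso; congruence);
  rewrite /from_left /over /positive /=; move: E1 E2 E3; clear;
  by case: b1 b2 b3 et em eb => [] [] [] [] [] [] //= _ _ _; case: sa sb sc => [] [] [].
Qed.

Lemma triangular_face_signs w k1 k2 k3 a b c sa sb sc et em eb :
  well_formed w -> (0 < k1 < size w)%N -> (0 < k2 < size w)%N -> (0 < k3 < size w)%N ->
  a != b -> a != c -> b != c ->
  perm_eq [seq [:: letter w k.-1; letter w k] | k <- [:: k1; k2; k3]]
    [:: flip et [:: (a, true, sa); (b, true, sb)];
        flip em [:: (a, false, sa); (c, true, sc)];
        flip eb [:: (b, false, sb); (c, false, sc)]] ->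
  triangular_face w k1 k2 k3 ->
  et (+) em = sb (+) sc /\ et (+) eb = sa (+) sc.
Proof.
move=> wf lt1 lt2 lt3 ab ac bc ps [d1 [d2 [d3 [/and4P[/eqP s1 /eqP s2 /eqP s3 _] pd]]]].
pose sides (k : nat) := [:: letter w k.-1; letter w k].
have sideE (d : dart w) : sides d.1 =
    flip (~~ d.2) [:: letter w (source d); letter w (target d)].
  by case: d => k [].
have inner (d : dart w) : d \in [:: d1; d2; d3] -> (0 < d.1 < size w)%N.
  move=> /(map_f (fun d : dart w => d.1 : nat)); rewrite (perm_mem pd) !inE.
  by case/or3P => /eqP ->.
have := face_step_crossing wf (inner d1 _); have := face_step_crossing wf (inner d2 _).
have := face_step_crossing wf (inner d3 _); rewrite s1 s2 s3 !inE !eqxx !orbT.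
move=> /(_ isT) t3 /(_ isT) t2 /(_ isT) t1.
apply: triangle_signs ab ac bc _ t1 t2 t3.
rewrite -!sideE; apply: perm_trans ps; exact: (perm_map sides pd).
Qed.

(** The sign relations forced by the triangular region make the three label differences in
    [code_aip_triangle] agree before and after the move. *)
Lemma code_aip_Omega3 u0 u1 u2 u3 p1 p2 p3 a b c sa sb sc et em eb
  (w := u0 ++ p1 ++ u1 ++ p2 ++ u2 ++ p3 ++ u3)
  (w' := u0 ++ rev p1 ++ u1 ++ rev p2 ++ u2 ++ rev p3 ++ u3) :
  well_formed w -> well_formed w' ->
  perm_eq [:: p1; p2; p3]
    [:: flip et [:: (a, true, sa); (b, true, sb)];
        flip em [:: (a, false, sa); (c, true, sc)];
        flip eb [:: (b, false, sb); (c, false, sc)]] ->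
  triangular_face w (size u0).+1 (size u0 + size u1).+3 (size u0 + size u1 + size u2).+4.+1 ->
  code_aip w = code_aip w'.
Proof.
move=> wf wf' pe tri.
have [s2 s2' s2''] : [/\ size p1 = 2, size p2 = 2 & size p3 = 2]%N.
  have /allP sz : all (fun p => size p == 2%N) [:: p1; p2; p3].
    by rewrite (perm_all _ pe) /flip; case: et em eb {pe} => [] [] [].
  by split; apply/eqP/sz; rewrite !inE eqxx ?orbT.
have sw : size w = (size u0 + size u1 + size u2 + size u3 + 6)%N.
  by rewrite /w !size_cat s2 s2' s2''; lia.
have nth_pair (p : seq passage) i : size p = 2%N ->
    forall u v, i = (size u).+1 -> [:: letter (u ++ p ++ v) i.-1; letter (u ++ p ++ v) i] = p.
  case: p => [|x [|y [|]]] // _ u v ->.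
  by rewrite /letter /= !(nth_cat _ u) ltnn subnn ltnNge leqnSn subSnn.
(* Since no passage is repeated, the crossings [a], [b], [c] are distinct. *)
have uk : uniq [seq (crossing x, over x) | x <- flatten [:: p1; p2; p3]].
  have pw : perm_eq w (flatten [:: p1; p2; p3] ++ u0 ++ u1 ++ u2 ++ u3).
    by apply/permP => P; rewrite /w /= !count_cat /=; lia.
  case/andP: wf => + _; rewrite (perm_uniq (perm_map _ pw)) map_cat cat_uniq.
  by case/andP.
have [ab ac bc] : [/\ a != b, a != c & b != c].
  move: uk; rewrite (perm_uniq (perm_map _ (perm_flatten pe))).
  have pf : perm_eq (flatten [:: flip et [:: (a, true, sa); (b, true, sb)];
      flip em [:: (a, false, sa); (c, true, sc)]; flip eb [:: (b, false, sb); (c, false, sc)]])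
    [:: (a, true, sa); (b, true, sb); (a, false, sa); (c, true, sc);
        (b, false, sb); (c, false, sc)].
    exact: perm_cat (perm_flip et [:: _; _]) (perm_cat (perm_flip em [:: _; _])
      (perm_cat (perm_flip eb [:: _; _]) (perm_refl [::]))).
  rewrite (perm_uniq (perm_map _ pf)) /=.
  rewrite !inE /crossing /over /= !xpair_eqE !andbT !andbF !orbF.
  by rewrite /= negb_or => /and4P[/andP[ab ac] bc _ _].
set k1 := (size u0).+1 in tri; set k2 := (size u0 + size u1).+3 in tri.
set k3 := (size u0 + size u1 + size u2).+4.+1 in tri.
have lt1 : (0 < k1 < size w)%N by rewrite sw /k1; lia.
have lt2 : (0 < k2 < size w)%N by rewrite sw /k2; lia.
have lt3 : (0 < k3 < size w)%N by rewrite sw /k3; lia.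
have q1 : [:: letter w k1.-1; letter w k1] = p1 by apply: nth_pair.
have q2 : [:: letter w k2.-1; letter w k2] = p2.
  rewrite /w catA (catA _ u1); apply: nth_pair => //.
  by rewrite !size_cat s2 /k2; lia.
have q3 : [:: letter w k3.-1; letter w k3] = p3.
  rewrite /w catA (catA _ u1) (catA _ p2) (catA _ u2); apply: nth_pair => //.
  by rewrite !size_cat s2 s2' /k3; lia.
have ps := pe; have eqs : [:: p1; p2; p3] =
    [seq [:: letter w k.-1; letter w k] | k <- [:: k1; k2; k3]] by rewrite /= q1 q2 q3.
rewrite {}eqs in ps.
have [e1 e2] := triangular_face_signs wf lt1 lt2 lt3 ab ac bc ps tri.
have [G [x [y [z H]]]] := code_aip_triangle u0 u1 u2 u3 pe.
have -> : code_aip w = _ := H false wf; have -> : code_aip w' = _ := H true wf'.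
congr (G _ _ _); rewrite !jumpE; move: e1 e2; clear;
  by case: et em eb sa sb sc => [] [] [] [] [] [] //= _ _; rewrite /sign; ring.
Qed.

Lemma code_aip_move v w : well_formed v -> well_formed w -> code_move v w ->
  code_aip v = code_aip w.
Proof.
move=> wfv wfw vw; case: vw wfv wfw => [f u f_inj|u1 u2 c o s|u1 u2 u3 c d o s e|].
- exact: code_aip_relabel.
- exact: code_aip_Omega1.
- exact: code_aip_Omega2.
move=> u0 u1 u2 u3 p1 p2 p3 a b c sa sb sc et em eb pe tri wfv wfw.
exact: code_aip_Omega3 pe tri.
Qed.

Lemma diagram_aip_equiv D E : diagram_equiv D E -> diagram_aip D = diagram_aip E.
Proof.
elim=> {D E} [D E DE||D E _ ->|D E F _ -> _ ->] //.
by have [/andP[wfD _] /andP[wfE _]] := (valP D, valP E); apply: code_aip_move DE.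
Qed.

Theorem theorem4p10 (K : knotoid) :
  affine_index_polynomial K = subst_inv (affine_index_polynomial K) /\
  affine_index_polynomial K = affine_index_polynomial (knotoid_inverse K).
Proof.
rewrite /affine_index_polynomial; set D := repr K.
have /andP[wf sph] := valP D.
have sym : diagram_aip D = subst_inv (diagram_aip D).
  by rewrite /diagram_aip subst_inv_code_aip.
split=> //; rewrite sym.
transitivity (diagram_aip (diagram_inverse D)).
  by rewrite /diagram_aip /= code_aip_rev.
(* The representative chosen for the inverse class is only equivalent to [diagram_inverse D]. *)
apply/esym/diagram_aip_equiv/asboolP.
rewrite -[X in is_true X]/(equiv diagram_equiv_rel _ _); apply/eqmodP; exact: reprK.
Qed.
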